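(* Let $k\ge 2$ be an integer. For all integers $m$ and $n$, $$F^{(k)}_{m,n}=F^{(k)}_{n-k}F^{(k)}_{m}-F^{(k)}_{n}F^{(k)}_{m-k}.$$
   Context: The $k$-bonacci numbers $(F^{(k)}_n)_{n\in\mathbb{Z}}$ are the bi-infinite integer sequence with $F^{(k)}_0=\cdots=F^{(k)}_{k-2}=0$, $F^{(k)}_{k-1}=1$ and $F^{(k)}_n=\sum_{i=1}^k F^{(k)}_{n-i}$ for all $n\in\mathbb{Z}$ (for $k=2$ these are the Fibonacci numbers). Let $\phi_1,\dots,\phi_k\in\mathbb{C}$ be the roots of $x^k-x^{k-1}-\cdots-x-1$; they are distinct and nonzero. For integers $t_1,\dots,t_k$ let $\|t_1,\dots,t_k\|=\det(\phi_i^{t_j})_{1\le i,j\le k}$. The single-index numbers satisfy the Binet formula $F^{(k)}_n=\|0,1,\dots,k-2,n\|/\|0,1,\dots,k-1\|$. The two-index numbers are defined, for $m,n\in\mathbb{Z}$, by $$F^{(k)}_{m,n}=\frac{\|0,1,\dots,k-3,m,n\|}{\|0,1,\dots,k-1\|}$$ (for $k=2$ the numerator is $\|m,n\|$). *)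

(* Defs.v *)
From HB Require Import structures.
From mathcomp Require Import all_boot all_order all_algebra.
From mathcomp Require Import zify.

Set Implicit Arguments.
Unset Strict Implicit.
Unset Printing Implicit Defensive.

Import Order.TTheory GRing.Theory Num.Theory.

Local Open Scope ring_scope.

Definition is_kbonacci (k : nat) (F : int -> int) : Prop :=
  [/\ forall i : nat, (i < k.-1)%N -> F i%:Z = 0,
      F k.-1%:Z = 1
    & forall n : int, F n = \sum_(1 <= i < k.+1) F (n - i%:Z)].

Definition kbonacci_poly (C : fieldType) (k : nat) : {poly C} :=
  'X^k - \sum_(i < k) 'X^i.

(* phi lists the roots of the polynomial with multiplicity; they are in fact
   distinct in characteristic 0, so distinctness is not required here. *)
Definition is_kbonacci_roots (C : fieldType) (k : nat) (phi : 'I_k -> C) :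
    Prop :=
  kbonacci_poly C k = \prod_(i < k) ('X - (phi i)%:P).

Definition powdet (C : fieldType) (k : nat) (phi : 'I_k -> C)
    (t : 'I_k -> int) : C :=
  \det (\matrix_(i < k, j < k) (phi i ^ t j)).

(* The exponents 0, 1, ..., k-3, m, n, for k >= 2. *)
Definition two_index_exps (k : nat) (m n : int) (j : 'I_k) : int :=
  if (j < k - 2)%N then j%:Z else if j == (k - 2)%N :> nat then m else n.

Definition kbonacci2 (C : fieldType) (k : nat) (phi : 'I_k -> C) (m n : int) :
    C :=
  powdet phi (two_index_exps m n) / powdet phi (fun j => j%:Z).

(* Existence and uniqueness of the sequence characterised by [is_kbonacci]. *)

Lemma kbonacci_rec_shift (k : nat) (F : int -> int) (n : int) :
  is_kbonacci k F -> F (n + k%:Z) = \sum_(i < k) F (n + i%:Z).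
Proof.
case=> _ _ ->; rewrite big_add1 /= big_mkord (reindex_inj rev_ord_inj) /=.
apply: eq_bigr => i _; congr F.
by have := ltn_ord i; lia.
Qed.

Lemma is_kbonacci_uniq (k : nat) (F G : int -> int) :
  (0 < k)%N -> is_kbonacci k F -> is_kbonacci k G -> F =1 G.
Proof.
case: k => // k _ HF HG.
have HP n : forall i : 'I_k.+1, F (n + i%:Z) = G (n + i%:Z).
  elim/int_ind: n => [|n IH|n IH] i.
  - rewrite !add0r; case: HF HG => [F0 F1 _] [G0 G1 _].
    have := ltn_ord i; rewrite ltnS leq_eqVlt => /orP[/eqP ->|lt_ik].
      by rewrite F1 G1.
    by rewrite F0 // G0.
  - have E : n.+1%:Z + i%:Z = n%:Z + i.+1%:Z by rewrite -!PoszD addSnnS.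
    rewrite E; have := ltn_ord i; rewrite leq_eqVlt => /orP[/eqP ->|lt_ik].
      rewrite (kbonacci_rec_shift _ HF) (kbonacci_rec_shift _ HG).
      by apply: eq_bigr.
    exact: (IH (Ordinal lt_ik)).
  - have E j : - n.+1%:Z + j.+1%:Z = - n%:Z + j%:Z.
      by rewrite -addn1 -[j.+1]addn1 !PoszD opprD addrACA addNr addr0.
    case: i => [[|i] lt_ik] /=; last first.
      by rewrite E; apply: (IH (Ordinal (ltnW lt_ik))).
    have EF := kbonacci_rec_shift (- n.+1%:Z) HF.
    have EG := kbonacci_rec_shift (- n.+1%:Z) HG.
    rewrite !big_ord_recl /= !E in EF EG.
    apply: (addIr (\sum_(j < k) G (- n.+1%:Z + (lift ord0 j)%:Z))).
    rewrite -EG -(IH ord_max) /= EF; congr (_ + _); apply: eq_bigr => j _.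
    by rewrite /= /bump /= add1n E -(IH (widen_ord (leqnSn k) j)).
by move=> n; have := HP n ord0; rewrite /= addr0.
Qed.

Lemma is_kbonacci_exists (k : nat) :
  (0 < k)%N -> exists F : int -> int, is_kbonacci k F.
Proof.
case: k => // k _.
pose St := {ffun 'I_k.+1 -> int}.
pose step (s : St) : St := [ffun i : 'I_k.+1 =>
  if (i < k)%N then s (inord i.+1) else \sum_j s j].
pose back (s : St) : St := [ffun i : 'I_k.+1 =>
  if i == 0%N :> nat then s ord_max - \sum_(j < k) s (widen_ord (leqnSn k) j)
  else s (inord i.-1)].
have backK s : step (back s) = s.
  apply/ffunP => i; rewrite ffunE; case: ifP => lt_ik.
    by rewrite ffunE inordK //= inord_val.
  have -> : i = ord_max.
    apply/val_inj => /=; move: (ltn_ord i).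
    by rewrite ltnS leq_eqVlt lt_ik orbF => /eqP.
  rewrite big_ord_recl ffunE /= [X in _ + X](eq_bigr
    (fun j : 'I_k => s (widen_ord (leqnSn k) j))) ?subrK // => j _.
  rewrite ffunE /=; congr (s _).
  by apply/val_inj; rewrite /= /bump /= add0n inordK // ltnS ltnW.
pose s0 : St := [ffun i : 'I_k.+1 => ((i == k :> nat) : nat)%:Z].
pose W (n : int) : St := match n with
  | Posz m => iter m step s0 | Negz m => iter m.+1 back s0 end.
have WS n : W (n + 1) = step (W n).
  case: n => [m|[|m]].
  - by rewrite -PoszD addn1.
  - by rewrite [Negz 0 + 1]/= /W /= backK.
  - have -> : Negz m.+1 + 1 = Negz m.
      by rewrite !NegzE -addn1 PoszD opprD subrK.
    by rewrite [in RHS]/W iterS backK.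
have WE n (i : 'I_k.+1) : W n i = W (n + i%:Z) ord0.
  case: i => i lt_ik; elim: i lt_ik n => [|i IH] lt_ik n.
    by rewrite addr0; congr (W n _); apply/val_inj.
  have E : n + i.+1%:Z = (n + 1) + i%:Z by rewrite -addrA -PoszD add1n.
  rewrite /= E -(IH (ltnW lt_ik)) WS ffunE /= (_ : (i < k)%N) //.
  by congr (W n _); apply/val_inj; rewrite /= inordK.
have F0 (i : nat) : (i < k.+1)%N -> W i%:Z ord0 = ((i == k :> nat) : nat)%:Z.
  move=> lt_ik; have := WE 0 (Ordinal lt_ik); rewrite add0r /= => <-.
  by rewrite /= ffunE.
exists (fun n => W n ord0); split=> [i lt_ik||n] /=.
- by rewrite F0 ?(ltnW lt_ik) // ?ltnS ?(ltnW lt_ik) // (ltn_eqF lt_ik).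
- by rewrite F0 // eqxx.
have := WE (n - k.+1%:Z + 1) ord_max.
have -> : n - k.+1%:Z + 1 + (@ord_max k)%:Z = n.
  by rewrite -addrA -PoszD add1n subrK.
move=> <-; rewrite WS ffunE ltnn big_add1 /= big_mkord.
rewrite (reindex_inj rev_ord_inj) /=; apply: eq_bigr => j _.
by rewrite WE /=; congr (W _ ord0); have := ltn_ord j; lia.
Qed.

(* Main.v *)
Require Import Defs.
From mathcomp Require Import all_boot all_order all_algebra.
From mathcomp Require Import perm zify ring.
From mathcomp Require Import reals complex.

Import Order.TTheory GRing.Theory Num.Theory.

Local Open Scope ring_scope.
Local Open Scope complex_scope.

(** As functions of [m] alone and of [n] alone, both sides obey the [k]-bonacci
    recurrence: the determinant is linear in its last two columns, and each
    column [(phi_i ^ n)_i] obeys the recurrence in [n] because every [phi_i] is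
    a root of the polynomial.  A solution of the recurrence is determined by its
    values on [0, ..., k - 1] ([kbonacci_rec_eq]), so it is enough to compare the
    two sides for [m] and [n] in that range.  There the determinant has two equal
    columns unless [m] and [n] are [k - 2] and [k - 1] in some order, in which
    case it is the Vandermonde determinant up to sign.

    On the other side, subtracting two consecutive instances of the recurrence
    gives [F (n - k) = 2 F n - F (n + 1)], which turns the right-hand side into
    the Casorati determinant [F n * F (m + 1) - F (n + 1) * F m]; it involves
    only [F 0 = ... = F (k - 2) = 0] and [F (k - 1) = F k = 1] on the range.

    Dividing by the Vandermonde determinant requires the roots to be distinct.
    Multiplied by ['X - 1], the polynomial becomes ['X^(k.+1) - 2 'X^k + 1], whose
    multiple roots must equal [2k / (k + 1)]; substitution then yields
    [2 ^ k.+1 * k ^ k = k.+1 ^ k.+1], which is impossible for [k >= 2] since [k]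
    and [k + 1] are coprime ([kbonacci_roots_inj]). *)

(** * The linear recurrence *)

Definition kbonacci_rec (V : zmodType) (k : nat) (u : int -> V) : Prop :=
  forall n : int, u (n + k%:Z) = \sum_(i < k) u (n + i%:Z).

(** The recurrence can be run in both directions, since its last coefficient is
    invertible: [k] consecutive zeros propagate to every index. *)
Lemma kbonacci_rec_eq0 (V : zmodType) (k : nat) (u : int -> V) :
  (0 < k)%N -> kbonacci_rec V k u -> (forall i : 'I_k, u i%:Z = 0) ->
  forall n, u n = 0.
Proof.
case: k => // k _ Hu u0 n.
suff H (p : int) : forall i : 'I_k.+1, u (p + i%:Z) = 0.
  by have := H n ord0; rewrite addr0.
elim/int_ind: p => [|p IH|p IH] i; first by rewrite add0r.
- have -> : p.+1%:Z + i%:Z = p%:Z + i.+1%:Z by lia.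
  have := ltn_ord i; rewrite leq_eqVlt => /orP[/eqP ->|lt_ik].
    by rewrite Hu big1.
  exact: (IH (Ordinal lt_ik)).
- have E j : - p.+1%:Z + j.+1%:Z = - p%:Z + j%:Z by lia.
  case: i => [[|i] lt_ik] /=; last first.
    by rewrite E; apply: (IH (Ordinal (ltnW lt_ik))).
  have := Hu (- p.+1%:Z).
  rewrite big_ord_recl /= E (IH ord_max) big1 ?addr0 // => j _.
  by rewrite /bump /= add1n E (IH (widen_ord (leqnSn k) j)).
Qed.

Lemma kbonacci_rec_eq (V : zmodType) (k : nat) (u v : int -> V) :
  (0 < k)%N -> kbonacci_rec V k u -> kbonacci_rec V k v ->
  (forall i : 'I_k, u i%:Z = v i%:Z) -> u =1 v.
Proof.
move=> k_gt0 Hu Hv Euv n; apply/eqP; rewrite -subr_eq0; apply/eqP.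
apply: (kbonacci_rec_eq0 _ k (fun p => u p - v p)) => // [p|i].
  by rewrite Hu Hv sumrB.
by rewrite Euv subrr.
Qed.

(** Two consecutive instances of the recurrence telescope to a three-term
    relation. *)
Lemma kbonacci_rec_back (V : zmodType) (k : nat) (u : int -> V) (n : int) :
  kbonacci_rec V k u -> u (n - k%:Z) = u n *+ 2 - u (n + 1).
Proof.
move=> Hu; have En := Hu (n - k%:Z); have En1 := Hu (n - k%:Z + 1).
rewrite subrK in En.
have E : n - k%:Z + 1 + k%:Z = n + 1 by lia.
rewrite E in En1.
have S : u (n + 1) + u (n - k%:Z) = u n + u n.
  have T : u (n - k%:Z) + \sum_(i < k) u (n - k%:Z + i.+1%:Z) =
           \sum_(i < k) u (n - k%:Z + i%:Z) + u (n - k%:Z + k%:Z).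
    have /= <- := big_ord_recr (op := +%R) (idx := 0) k (fun i : 'I_k.+1 => u (n - k%:Z + i%:Z)).
    by rewrite big_ord_recl /= addr0.
  rewrite subrK -En in T; rewrite -T addrC En1; congr (_ + _).
  by apply: eq_bigr => i _; congr u; lia.
by rewrite mulr2n -S [_ + u (n - _)]addrC addrK.
Qed.

(** * Roots of the polynomial *)

(** The geometric sum disappears, leaving a trinomial whose derivative is easy
    to factor. *)
Lemma kbonacci_poly_mul_subX1 (C : fieldType) (k : nat) :
  ('X - 1) * kbonacci_poly C k = 'X^(k.+1) - 'X^k *+ 2 + 1.
Proof.
rewrite /kbonacci_poly mulrBr -subrX1 mulrBl mul1r -exprS; ring.
Qed.

Section Roots.

Variables (C : numFieldType) (k : nat) (phi : 'I_k -> C).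
Hypothesis hphi : is_kbonacci_roots phi.

Lemma kbonacci_rootP (i : 'I_k) : phi i ^+ k = \sum_(j < k) phi i ^+ j.
Proof.
have : (kbonacci_poly C k).[phi i] = 0.
  by rewrite hphi (bigD1 i) //= hornerM hornerXsubC subrr mul0r.
rewrite /kbonacci_poly hornerD hornerN hornerXn horner_sum => /subr0_eq ->.
by apply: eq_bigr => j _; rewrite hornerXn.
Qed.

Lemma kbonacci_root_neq0 (i : 'I_k) : phi i != 0.
Proof.
apply/eqP => phi0; have := kbonacci_rootP i; rewrite phi0.
case: k i {phi0} => [[]//|q] _.
rewrite big_ord_recl big1 => [|j _]; rewrite !expr0n //= addr0.
by move/esym/eqP; rewrite oner_eq0.
Qed.

Lemma kbonacci_root_rec (i : 'I_k) : kbonacci_rec C k (exprz (phi i)).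
Proof.
move=> n; rewrite expfzDr ?kbonacci_root_neq0 // -exprnP kbonacci_rootP mulr_sumr.
by apply: eq_bigr => j _; rewrite expfzDr ?kbonacci_root_neq0.
Qed.

(** A repeated root [x] would be a multiple root of the trinomial
    ['X^(k.+1) - 2 'X^k + 1].  Its derivative forces [x = 2k / (k + 1)], which
    turns [x ^ k * (2 - x) = 1] into an equation between natural numbers that
    is impossible modulo [k]. *)
Lemma kbonacci_roots_inj : (2 <= k)%N -> injective phi.
Proof.
move=> hk i j Eij; apply/eqP/negPn/negP => ne_ij.
set x := phi i.
have [Q EQ] : exists Q, 'X^(k.+1) - 'X^k *+ 2 + 1 = ('X - x%:P) * ('X - x%:P) * Q.
  rewrite -kbonacci_poly_mul_subX1 hphi (bigD1 i) //= (bigD1 j) 1?eq_sym //=.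
  rewrite -Eij -/x; eexists.
  by rewrite mulrCA -!mulrA [('X - 1) * _]mulrCA.
have E0 : x ^+ k.+1 - x ^+ k *+ 2 + 1 = 0.
  have := congr1 (fun p => p.[x]) EQ.
  by rewrite !hornerE subrr !mul0r.
have E1 : x * (k.+1)%:R = (k * 2)%:R.
  have /= := congr1 (fun p => (p^`()).[x]) EQ.
  have -> : (('X - x%:P) * ('X - x%:P) * Q)^`().[x] = 0.
    by rewrite -mulrA derivM derivXsubC mul1r hornerD !hornerM hornerXsubC subrr
               !mul0r addr0.
  rewrite derivD derivB derivMn !derivXn -[1]/(1%:P) derivC addr0.
  rewrite hornerD hornerN !hornerMn !hornerXn /=.
  have -> : x ^+ k = x ^+ k.-1 * x by rewrite -exprSr prednK // ltnW.
  rewrite -mulrnA -[_ *+ k.+1]mulr_natr -[_ *+ (k * 2)]mulr_natr -mulrA -mulrBr => /eqP.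
  rewrite mulf_eq0 expf_eq0 (negPf (kbonacci_root_neq0 i)) andbF /=.
  by rewrite subr_eq0 => /eqP.
(* The equation [x ^ k * (2 - x) = 1] multiplied by [k.+1 ^ k.+1]; by [E1],
   [k.+1 * (2 - x) = 2]. *)
have E2 : ((k * 2) ^ k * 2 = k.+1 ^ k.+1)%N.
  apply/eqP; rewrite -(eqr_nat C) natrM !natrX -E1 exprMn exprS.
  have E3 : x ^+ k * (2 * k.+1%:R - x * k.+1%:R) = k.+1%:R.
    rewrite -[RHS]subr0 -[in RHS](mulr0 (k.+1%:R)) -E0 exprS; ring.
  have E4 : 2 * k.+1%:R - x * k.+1%:R = 2 :> C.
    by rewrite E1 -natrM -natrB; [congr (_%:R); lia | lia].
  rewrite E4 in E3.
  by rewrite -mulrA [_ * 2]mulrC mulrA -E3; apply/eqP; ring.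
have : (k %| k.+1 ^ k.+1)%N.
  by rewrite -E2 expnMn -mulnA dvdn_mulr // dvdn_exp // ltnW.
have cop : coprime k (k.+1 ^ k.+1) by rewrite coprimeXr // coprimenS.
by rewrite -[X in (_ %| X)%N]mul1n Gauss_dvdl // dvdn1; case: (k) hk => [|[]].
Qed.

(** * Determinants of powers of the roots *)

(** Expansion along column [j] exhibits the determinant as a combination, with
    coefficients free of [n], of the sequences [phi_i ^ n]. *)
Lemma powdet_rec (j : 'I_k) (t : int -> 'I_k -> int) :
  (forall n, t n j = n) ->
  (forall n n' l, l != j -> t n l = t n' l) ->
  kbonacci_rec C k (fun n => powdet phi (t n)).
Proof.
move=> tj tl n.
pose c (i : 'I_k) := cofactor (\matrix_(a < k, b < k) (phi a ^ t 0 b)) i j.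
have E p : powdet phi (t p) = \sum_i phi i ^ p * c i.
  rewrite /powdet (expand_det_col _ j); apply: eq_bigr => i _.
  rewrite mxE tj; congr (_ * (_ * \det _)); apply/matrixP => a b; rewrite !mxE.
  by rewrite (tl p 0) // eq_sym neq_lift.
under [RHS]eq_bigr => i _ do rewrite E.
rewrite E exchange_big /=; apply: eq_bigr => i _.
by rewrite kbonacci_root_rec mulr_suml.
Qed.

Lemma powdet_eq0 (t : 'I_k -> int) (j l : 'I_k) :
  j != l -> t j = t l -> powdet phi t = 0.
Proof.
move=> ne_jl Et; rewrite /powdet -det_tr.
by apply: (determinant_alternate ne_jl) => i; rewrite !mxE Et.
Qed.

Lemma powdet_perm (t : 'I_k -> int) (j l : 'I_k) :
  j != l -> powdet phi (t \o tperm j l) = - powdet phi t.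
Proof.
move=> ne_jl; rewrite /powdet -[in RHS]mulN1r.
have := det_perm C (tperm j l); rewrite odd_tperm ne_jl expr1 => <-.
rewrite mulrC -det_mulmx; congr (\det _).
rewrite -[X in perm_mx X]tpermV -col_permE.
by apply/matrixP => a b; rewrite !mxE.
Qed.

Lemma powdet_Vandermonde_neq0 :
  injective phi -> powdet phi (fun j => j%:Z) != 0.
Proof.
move=> phiI; rewrite /powdet -det_tr.
have -> : (\matrix_(i < k, j < k) (phi i ^ j%:Z))^T =
          Vandermonde k (\row_i phi i).
  by apply/matrixP => i j; rewrite !mxE.
rewrite det_Vandermonde; apply/prodf_neq0 => i _; apply/prodf_neq0 => j lt_ij.
rewrite !mxE subr_eq0; apply: contraTneq lt_ij => /phiI ->.
by rewrite ltnn.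
Qed.

End Roots.

(** * The two-index formula *)

Lemma kbonacci_rec_comb (C : fieldType) (k : nat) (u : int -> C) (a b : C) :
  kbonacci_rec C k u -> kbonacci_rec C k (fun n => a * u n + b * u (n + 1)).
Proof.
move=> Hu n; rewrite big_split /= -!mulr_sumr Hu addrAC Hu.
by congr (_ + _ * _); apply: eq_bigr => i _; rewrite addrAC.
Qed.

Lemma kbonacci_small (k : nat) (F : int -> int) (i : nat) :
  (0 < k)%N -> is_kbonacci k F -> (i < k)%N -> F i%:Z = (i == k.-1)%:Z.
Proof.
move=> k_gt0 [F0 F1 _] lt_ik; case: eqVneq => [->|ne_i]; first exact: F1.
by apply: F0; move/eqP: ne_i; lia.
Qed.

Lemma kbonacci_small_succ (k : nat) (F : int -> int) (i : nat) :
  (0 < k)%N -> is_kbonacci k F -> (i < k)%N ->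
  F (i%:Z + 1) = (k.-2 <= i)%N%:Z.
Proof.
move=> k_gt0 hF; rewrite -PoszD addn1 leq_eqVlt => /orP[/eqP Ei|lt_ik].
  rewrite Ei -[k%:Z]add0r (kbonacci_rec_shift 0 hF).
  have lt_k : (k.-1 < k)%N by rewrite prednK.
  rewrite (bigD1 (Ordinal lt_k)) //= add0r (kbonacci_small k) // eqxx.
  rewrite big1 => [|l ne_l]; first by have -> : (k.-2 <= i)%N by lia.
  rewrite add0r (kbonacci_small k) //.
  by move: ne_l; rewrite -val_eqE /= => /negPf ->.
rewrite (kbonacci_small k) //; congr (nat_of_bool _)%:Z.
by apply/idP/idP; lia.
Qed.

(** For [m] and [n] in [0, ..., k - 1] both sides, multiplied by the Vandermonde
    determinant [D], are [D] at [(k - 2, k - 1)], [- D] at [(k - 1, k - 2)] and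
    [0] elsewhere; the recurrence in each variable does the rest. *)
Lemma kbonacci2_eq (C : numFieldType) (k : nat) (F : int -> int)
    (phi : 'I_k -> C) (m n : int) :
  (2 <= k)%N -> is_kbonacci k F -> is_kbonacci_roots phi ->
  kbonacci2 phi m n = (F (n - k%:Z) * F m - F n * F (m - k%:Z))%:~R.
Proof.
move=> hk hF hphi; have k_gt0 : (0 < k)%N by apply: ltnW.
have hFr : kbonacci_rec int k F by move=> p; apply: kbonacci_rec_shift.
(* Removing the negative shifts leaves only values at [n], [n + 1], [m] and
   [m + 1], all explicit when [m] and [n] lie in [0, ..., k - 1]. *)
have -> : F (n - k%:Z) * F m - F n * F (m - k%:Z) =
          F n * F (m + 1) - F (n + 1) * F m.
  by rewrite !(kbonacci_rec_back _ k F) // !mulr2n; ring.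
have lt1 : (k - 2 < k)%N by lia.
have lt2 : (k - 1 < k)%N by lia.
(* The columns carrying [m] and [n]. *)
pose j1 := Ordinal lt1; pose j2 := Ordinal lt2.
have ne12 : j1 != j2 by rewrite -val_eqE /=; lia.
have e1 p q : two_index_exps p q j1 = p by rewrite /two_index_exps /= ltnn eqxx.
have e2 p q : two_index_exps p q j2 = q.
  by rewrite /two_index_exps /= ifF ?ifF //; lia.
have e3 p q (l : 'I_k) : (l < k - 2)%N -> two_index_exps p q l = l%:Z.
  by rewrite /two_index_exps => ->.
have ordP (l : 'I_k) : [\/ (l < k - 2)%N, l = j1 | l = j2].
  have [lt_l|le_l] := ltnP l (k - 2); first by constructor 1.
  have [El|ne_l] := eqVneq (l : nat) (k - 2)%N.
    by constructor 2; apply: val_inj.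
  by constructor 3; apply: val_inj => /=; have := ltn_ord l; lia.
pose D := powdet phi (fun j => j%:Z).
have D0 : D != 0.
  by apply: powdet_Vandermonde_neq0; apply: kbonacci_roots_inj hk.
pose f p : C := (F p)%:~R.
have fr : kbonacci_rec C k f by move=> p; rewrite /f hFr rmorph_sum.
pose G p q := powdet phi (two_index_exps p q).
pose Rhs p q := D * (f q * f (p + 1) - f (q + 1) * f p).
have Gl q : kbonacci_rec C k (G ^~ q).
  apply: (powdet_rec _ _ _ _ j1) => // p p' l ne_l.
  by case: (ordP l) ne_l => [lt_l|->|->]; rewrite ?eqxx // ?e2 // !e3.
have Gr p : kbonacci_rec C k (G p).
  apply: (powdet_rec _ _ _ _ j2) => // q q' l ne_l.
  by case: (ordP l) ne_l => [lt_l|->|->]; rewrite ?eqxx // ?e1 // !e3.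
have Rl q : kbonacci_rec C k (Rhs ^~ q).
  move=> p; have := kbonacci_rec_comb _ _ _ (- (D * f (q + 1))) (D * f q) fr p.
  have E x : - (D * f (q + 1)) * f x + D * f q * f (x + 1) = Rhs x q.
    by rewrite /Rhs; ring.
  by rewrite E => ->; apply: eq_bigr => i _; rewrite E.
have Rr p : kbonacci_rec C k (Rhs p).
  move=> q; have := kbonacci_rec_comb _ _ _ (D * f (p + 1)) (- (D * f p)) fr q.
  have E x : D * f (p + 1) * f x + - (D * f p) * f (x + 1) = Rhs p x.
    by rewrite /Rhs; ring.
  by rewrite E => ->; apply: eq_bigr => i _; rewrite E.
have swap p q : G p q = - G q p.
  rewrite /G -(powdet_perm _ _ _ _ _ _ ne12) /powdet; congr (\det _).
  apply/matrixP => a b; rewrite !mxE /=; congr (_ ^ _).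
  case: (ordP b) => [lt_b|->|->]; rewrite ?tpermL ?tpermR ?e1 ?e2 //.
  by rewrite tpermD ?e3 // -val_eqE /= gtn_eqF //; lia.
have fE (l : 'I_k) : f l%:Z = (l == j2)%:R.
  by rewrite /f (kbonacci_small k) // -val_eqE /= subn1.
have f1E (l : 'I_k) : f (l%:Z + 1) = (l == j1)%:R + (l == j2)%:R.
  rewrite /f (kbonacci_small_succ k F) // -!val_eqE /= -natrD; congr (_%:R).
  by have := ltn_ord l; lia.
have G12 : G j1%:Z j2%:Z = D.
  rewrite /G /D /powdet; congr (\det _); apply/matrixP => a b; rewrite !mxE.
  by case: (ordP b) => [lt_b|->|->]; rewrite ?e1 ?e2 ?e3.
(* An exponent below [k - 2] repeats one of the fixed columns. *)
have Gsmall (l l' : 'I_k) : (l < k - 2)%N -> G l%:Z l'%:Z = 0.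
  move=> lt_l; apply: (powdet_eq0 _ _ _ _ l j1); last by rewrite e1 e3.
  by rewrite -val_eqE /= ltn_eqF.
have Gdiag p : G p p = 0 by apply: (powdet_eq0 _ _ _ _ _ _ ne12); rewrite e1 e2.
have small (l : 'I_k) : (l < k - 2)%N -> (l == j1 = false) * (l == j2 = false).
  by move=> lt_l; rewrite -!val_eqE /=; split; apply/eqP; lia.
have ne21 : (j2 == j1) = false by rewrite eq_sym; apply/negbTE.
have base (i j : 'I_k) : G i%:Z j%:Z = Rhs i%:Z j%:Z.
  rewrite /Rhs !fE !f1E.
  case: (ordP i) => [lt_i|->|->].
  - by rewrite Gsmall // !(small i lt_i) /=; ring.
  - case: (ordP j) => [lt_j|->|->].
    + by rewrite swap Gsmall // !(small j lt_j) /=; ring.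
    + by rewrite Gdiag eqxx (negPf ne12) /=; ring.
    + by rewrite G12 !eqxx (negPf ne12) ne21 /=; ring.
  - case: (ordP j) => [lt_j|->|->].
    + by rewrite swap Gsmall // !(small j lt_j) /=; ring.
    + by rewrite swap G12 !eqxx (negPf ne12) ne21 /=; ring.
    + by rewrite Gdiag eqxx ne21 /=; ring.
suff E : G m n = Rhs m n.
  rewrite /kbonacci2 -/(G m n) -/D E /Rhs /f mulrC mulKf //.
  by rewrite rmorphB !rmorphM.
(* Uniqueness in [m]; each initial value [m = i] is settled by uniqueness in [n]. *)
apply: (kbonacci_rec_eq _ k (G ^~ n) (Rhs ^~ n)) => // i.
by apply: (kbonacci_rec_eq _ k (G i) (Rhs i)).
Qed.

Theorem theorem7p2 (R : realType) (k : nat) (hk : (2 <= k)%N)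
    (F : int -> int) (hF : is_kbonacci k F)
    (phi : 'I_k -> R[i]) (hphi : is_kbonacci_roots phi) (m n : int) :
  kbonacci2 phi m n =
    (F (n - k%:Z) * F m - F n * F (m - k%:Z))%:~R.
Proof.
exact: kbonacci2_eq.
Qed.
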